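(* For an integer $m\ge0$ let $\mathbf{S}_m=\{1,\dots,m\}^2$, where a square $(i,j)$ has column $i$ and row $j$. Two distinct squares $(i,j),(i',j')$ attack each other (as anassas, with moves $(0,1)$ and $(1,1)$) if $i=i'$ or $i-j=i'-j'$. Let $A_{\mathbf{S}}(m,k,p)$ be the number of $k$-element subsets of $\mathbf{S}_m$ with no two elements attacking each other and with exactly $p$ elements $(i,j)$ satisfying $j<i$ (strictly below the main diagonal); set $A_{\mathbf{S}}(m,k,p)=0$ if $k<0$ or $p<0$. Then for integers $m\ge1$ and $k,p\ge 0$, $$A_{\mathbf{S}}(m,k,p)=A_{\mathbf{S}}(m-1,k,p)+(m-k+1)A_{\mathbf{S}}(m-1,k-1,p)+(m-p)A_{\mathbf{S}}(m-1,k-1,p-1)+(m-p)(m-k+1)A_{\mathbf{S}}(m-1,k-2,p-1),$$ with $A_{\mathbf{S}}(0,k,p)=\delta_{k0}\delta_{p0}$, $A_{\mathbf{S}}(m,0,p)=\delta_{p0}$, $A_{\mathbf{S}}(m,1,p)=\left\{ {m+1 \atop m}\right\}\delta_{p0}+\left\{ {m \atop m-1}\right\}\delta_{p1}$ and $A_{\mathbf{S}}(m,k,0)=\left\{ {m+1 \atop m-k+1}\right\}$. Moreover, for all integers $m,k,p\ge0$, $$A_{\mathbf{S}}(m,k,p)=\sum_{j=0}^{p}(m-k+j)_j\binom{k-p-1}{j}\binom{k-j}{k-p}\left\{ {m+1 \atop m-k+j+1}\right\}.$$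
   Context: $\delta_{ij}$ is the Kronecker delta and $(x)_j=x(x-1)\cdots(x-j+1)$, $(x)_0=1$. Stirling numbers of the second kind $\left\{ {n \atop r}\right\}$ are used in the extended sense for all integers: usual values for $n,r\ge0$; $\left\{ {n \atop r}\right\}=\left[{-r\atop -n}\right]$ (unsigned Stirling number of the first kind) for $n,r\le0$; and $0$ when one of $n,r$ is positive and the other negative. Binomial coefficients are extended to all integers $n,r$ (Kronenburg's convention): $\binom{n}{r}=n(n-1)\cdots(n-r+1)/r!$ if $r\ge0$; $\binom{n}{r}=(-1)^{n-r}\binom{-r-1}{n-r}$ if $r\le n<0$; and $\binom{n}{r}=0$ otherwise. *)

(* Defs.v *)
From HB Require Import structures.
From mathcomp Require Import all_boot all_order all_algebra.
Set Implicit Arguments. Unset Strict Implicit. Unset Printing Implicit Defensive.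
Import Order.TTheory GRing.Theory Num.Theory.
Local Open Scope ring_scope.

(* Squares of the m x m board: pairs (column, row). We index columns and rows
   by 'I_m = {0,...,m-1} instead of {1,...,m}; all conditions below
   (i = i', i - j = i' - j', j < i) are invariant under this shift. *)
Definition attack (m : nat) (a b : 'I_m * 'I_m) : bool :=
  (a != b) &&
  ((a.1 == b.1) || ((a.1 : nat)%:Z - (a.2 : nat)%:Z == (b.1 : nat)%:Z - (b.2 : nat)%:Z)).

Definition nonattacking (m : nat) (S : {set 'I_m * 'I_m}) : bool :=
  [forall a in S, forall b in S, ~~ attack a b].

Definition below (m : nat) (S : {set 'I_m * 'I_m}) : nat :=
  #|[set a in S | (a.2 < a.1)%N]|.

Definition AS_nat (m k p : nat) : nat :=
  #|[set S : {set 'I_m * 'I_m} | [&& nonattacking S, #|S| == k & below S == p]]|.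

Definition AS (m : nat) (k p : int) : int :=
  if (k < 0) || (p < 0) then 0 else (AS_nat m `|k|%N `|p|%N)%:Z.

Fixpoint stir2 (n k : nat) : nat :=
  match n, k with
  | 0, 0 => 1
  | 0, _.+1 => 0
  | _.+1, 0 => 0
  | n'.+1, k'.+1 => k'.+1 * stir2 n' k'.+1 + stir2 n' k'
  end%N.

Fixpoint stir1 (n k : nat) : nat :=
  match n, k with
  | 0, 0 => 1
  | 0, _.+1 => 0
  | _.+1, 0 => 0
  | n'.+1, k'.+1 => n' * stir1 n' k'.+1 + stir1 n' k'
  end%N.

Definition stirlingZ (n r : int) : int :=
  if (0 <= n) && (0 <= r) then (stir2 `|n|%N `|r|%N)%:Z
  else if (n <= 0) && (r <= 0) then (stir1 `|r|%N `|n|%N)%:Z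
  else 0.

Definition ffact (x : int) (j : nat) : int := \prod_(i < j) (x - (i : nat)%:Z).

(* n(n-1)...(n-r+1)/r! for r >= 0 (exact integer division) *)
Definition binom_pos (n : int) (r : nat) : int :=
  ((\prod_(i < r) (n - (i : nat)%:Z)) %/ (r`!)%:Z)%Z.

(* Kronenburg's extension of binomial coefficients to all integers *)
Definition binomZ (n r : int) : int :=
  if 0 <= r then binom_pos n `|r|%N
  else if (r <= n) && (n < 0) then (-1) ^+ `|n - r|%N * binom_pos (- r - 1) `|n - r|%N
  else 0.

Definition kdelta (a b : int) : int := if a == b then 1 else 0.

(* Main.v *)
Require Import Defs.
From HB Require Import structures.
From mathcomp Require Import all_boot all_order all_algebra zify ring.
Import Order.TTheory GRing.Theory Num.Theory.

Set Implicit Arguments.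
Unset Strict Implicit.
Unset Printing Implicit Defensive.

Local Open Scope ring_scope.

(** The main diagonal is a clique of the attack relation, so it carries at most one
    piece, and that piece only has to avoid the columns of the others. The board of
    side [m + 1] without its diagonal is a copy of the board of side [m], since moving
    the squares above the diagonal down by one merely relabels diagonals, together with
    the squares of the last column below the diagonal. These form a clique again, and a
    piece there only has to avoid the diagonals of the other below-diagonal pieces. The
    recurrence is the composition of these two steps.

    For the closed formula fix the number [u = k - p] of pieces that are not below the
    diagonal, let [A_u] ([AS_poly m u]) be the sum of [AS m k (k - u) X^(m - k)] over [k],
    and let [O_u] ([AS_offdiag_poly m u]) be the analogous polynomial for the board
    without its diagonal. With the operator [D = 1 + d/dX] ([addderiv]) the two steps
    become
      [A_0 = O_0],  [A_(u+1) = O_(u+1) + O_u']  and  [O_u = D(A_u) X + u A_u],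
    where the last [O_u] belongs to side [m + 1]. Because [D^u (q X) = (D^u q) X + u
    D^(u-1) q], induction on [m] shows that [A_(u+1)] is the image under [D^u] of the
    polynomial with coefficients [C(m - n, u + 1) S(m + 1, n + 1)], whereas [A_0] is the
    Touchard polynomial, with coefficients [S(m, n)]. Expanding [D^u] gives the formula
    for [k > p]; for [k = p] it is a telescoping alternating sum. *)

Section FiniteSets.

Variables T U : finType.

Lemma double_count (r : T -> U -> bool) (A : {set T}) (B : {set U}) :
  (\sum_(x in A) #|[set y in B | r x y]| = \sum_(y in B) #|[set x in A | r x y]|)%N.
Proof.
under eq_bigr do rewrite -sum1dep_card big_mkcondr.
rewrite exchange_big; apply: eq_bigr => y _.
by rewrite -big_mkcondr sum1dep_card.
Qed.

Lemma imset_preimset (f : T -> U) (A : {set T}) (S : {set U}) :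
  S \subset f @: A -> f @: (f @^-1: S) = S.
Proof.
move=> /subsetP SfA; apply/setP => y; apply/imsetP/idP => [[x] | yS].
  by rewrite inE => ? ->.
by have /imsetP[x _ yE] := SfA y yS; exists x; rewrite // inE -yE.
Qed.

End FiniteSets.

Section IndependentSets.

Variables (T : finType) (e : rel T).

Definition independent (S : {set T}) : bool := [forall a in S, forall b in S, ~~ e a b].

Definition nonadjacent (S : {set T}) (q : T) : bool := [forall s in S, ~~ e q s].

Definition indep_sets (B A : {set T}) (k p : int) : {set {set T}} :=
  [set S : {set T} |
    [&& S \subset A, independent S, #|S|%:Z == k & #|S :&: B|%:Z == p]].

Lemma independentP (S : {set T}) :
  reflect {in S &, forall a b, ~~ e a b} (independent S).
Proof.
apply: (iffP forall_inP) => [indS a b aS bS | indS a aS].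
  exact: (forall_inP (indS a aS)).
by apply/forall_inP => b; apply: indS.
Qed.

Lemma independentS (S S' : {set T}) : S \subset S' -> independent S' -> independent S.
Proof.
move=> /subsetP SS' /independentP indS'; apply/independentP => a b aS bS.
by rewrite indS' ?SS'.
Qed.

Lemma independentU1 (S : {set T}) (q : T) :
  symmetric e -> irreflexive e ->
  independent (q |: S) = nonadjacent S q && independent S.
Proof.
move=> e_sym e_irr; apply/idP/andP => [indqS | [qS /independentP indS]].
  split; last exact: independentS (subsetU1 q S) indqS.
  by apply/forall_inP => s sS; rewrite (independentP _ indqS) ?setU11 ?setU1r.
apply/independentP => a b /setU1P[-> | aS] /setU1P[-> | bS].
- by rewrite e_irr.
- exact: (forall_inP qS).
- by rewrite e_sym (forall_inP qS).
- exact: indS.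
Qed.

Lemma indep_sets_eq0 (B A : {set T}) (k p : int) :
  ~~ (0 <= p <= k) -> indep_sets B A k p = set0.
Proof.
move=> pk; apply/setP => S; rewrite !inE; apply/negP => /and4P[_ _ kS pS].
by have := subset_leq_card (subsetIl S B); lia.
Qed.

Lemma card_nonadjacent_inj (Q S D : {set T}) (f : T -> T) :
  D \subset S -> {in D, forall s, f s \in Q} -> {in D &, injective f} ->
  {in Q & S, forall q s, e q s = (s \in D) && (f s == q)} ->
  #|[set q in Q | nonadjacent S q]|%:Z = #|Q|%:Z - #|D|%:Z.
Proof.
move=> /subsetP DS fQ f_inj eE; have fDQ : f @: D \subset Q.
  by apply/subsetP => _ /imsetP[s sD ->]; apply: fQ.
have -> : [set q in Q | nonadjacent S q] = Q :\: f @: D.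
  apply/setP => q; rewrite !inE andbC; apply: andb_id2r => qQ.
  apply/forall_inP/negP => [qS /imsetP[s sD qE] | qfD s sS].
    by have := qS s (DS _ sD); rewrite eE ?DS // sD qE eqxx.
  by rewrite eE //; apply/negP => /andP[sD /eqP sq]; case: qfD; rewrite -sq imset_f.
by rewrite cardsDS // -subzn ?subset_leq_card // card_in_imset.
Qed.

Section AddClique.

Variables (B A Q : {set T}) (b : bool).
Hypotheses (e_sym : symmetric e) (e_irr : irreflexive e).
Hypothesis disjointAQ : [disjoint A & Q].
Hypothesis cliqueQ : {in Q &, forall x y, x != y -> e x y}.
Hypothesis QB : {in Q, forall q, (q \in B) = b}.

Lemma indep_setsU1 (S : {set T}) (q : T) (k p : int) : q \in Q -> q \notin S ->
  (q |: S \in indep_sets B (A :|: Q) k p)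
  = (S \in indep_sets B A (k - 1) (p - b%:Z)) && nonadjacent S q.
Proof.
move=> qQ qS; rewrite !inE independentU1 // [RHS]andbC -!andbA.
have -> : (#|q |: S|%:Z == k) = (#|S|%:Z == k - 1) by rewrite cardsU1 qS; lia.
have -> : (#|(q |: S) :&: B|%:Z == p) = (#|S :&: B|%:Z == p - b%:Z).
  rewrite (cardsD1 q (_ :&: B)) -setIDAC setU1K // !inE eqxx /= QB //.
  by rewrite PoszD addrC -subr_eq opprK.
rewrite [LHS]andbCA; apply: andb_id2l => /forall_inP qfree; congr (_ && _).
apply/subsetP/subsetP => [SAQ s sS | SA s].
  have /setUP[// | sQ] := SAQ s (setU1r q sS).
  by have := qfree s sS; rewrite cliqueQ //; apply: contraNneq qS => ->.
by case/setU1P => [-> | /SA sA]; rewrite inE ?qQ ?sA ?orbT.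
Qed.

Lemma card_indep_sets_mem (q : T) (k p : int) : q \in Q ->
  #|[set S in indep_sets B (A :|: Q) k p | q \in S]|
  = #|[set S in indep_sets B A (k - 1) (p - b%:Z) | nonadjacent S q]|.
Proof.
move=> qQ; set F := [set S in indep_sets B A _ _ | _].
have qF S : S \in F -> q \notin S.
  rewrite !inE => /andP[/and4P[/subsetP SA _ _ _] _].
  by apply: contraTN qQ => /SA qA; rewrite (disjointFr disjointAQ).
rewrite -(@card_in_imset _ _ (setU [set q]) F); last first.
  by move=> S S' /qF qS /qF qS' eqU; rewrite -(setU1K qS) eqU setU1K.
apply: eq_card => S; rewrite inE; apply/andP/imsetP => [[SF qS] | [S' S'F ->]].
  exists (S :\ q); last by rewrite setD1K.
  by rewrite inE -indep_setsU1 ?setD1K // !inE eqxx.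
by rewrite setU11 indep_setsU1 ?qF //; move: S'F; rewrite inE.
Qed.

Lemma card_indep_sets_disjoint (k p : int) :
  #|[set S in indep_sets B (A :|: Q) k p | S :&: Q == set0]| = #|indep_sets B A k p|.
Proof.
have AE : A = (A :|: Q) :\: Q by rewrite setDUl setDv setU0; apply/esym/setDidPl.
by apply: eq_card => S; rewrite !inE [in RHS]AE subsetD setI_eq0 -!andbA; do !bool_congr.
Qed.

Lemma independent_setI_clique (S : {set T}) : independent S -> (#|S :&: Q| <= 1)%N.
Proof.
move=> /independentP indS; apply/card_le1_eqP => x y /setIP[xS xQ] /setIP[yS yQ].
by apply: contraNeq (indS _ _ yS xS); apply: cliqueQ.
Qed.

Lemma card_indep_sets_setU_clique (k p : int) :
  #|indep_sets B (A :|: Q) k p|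
  = (#|indep_sets B A k p|
     + \sum_(S in indep_sets B A (k - 1) (p - b%:Z)) #|[set q in Q | nonadjacent S q]|)%N.
Proof.
rewrite double_count -card_indep_sets_disjoint.
under eq_bigr do rewrite -?card_indep_sets_mem //.
rewrite -double_count -!sum1_card.
under [X in (X + _)%N]eq_bigl do rewrite inE.
rewrite big_mkcondr -big_split /=; apply: eq_bigr => S; rewrite inE => /and4P[_ indS _ _].
have -> : [set q in Q | q \in S] = S :&: Q by apply/setP => q; rewrite !inE andbC.
by have := independent_setI_clique indS; rewrite -cards_eq0; case: #|_| => [|[]].
Qed.

Lemma card_indep_sets_setU_clique_const (k p c : int) :
  {in indep_sets B A (k - 1) (p - b%:Z),
     forall S, #|[set q in Q | nonadjacent S q]|%:Z = c} ->
  #|indep_sets B (A :|: Q) k p|%:Z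
  = #|indep_sets B A k p|%:Z + c * #|indep_sets B A (k - 1) (p - b%:Z)|%:Z.
Proof.
move=> cE; rewrite card_indep_sets_setU_clique PoszD; congr (_ + _).
rewrite -[Posz _]natz natr_sum (eq_bigr (fun=> c)) => [|S SF]; last by rewrite natz cE.
by rewrite sumr_const -mulr_natr natz.
Qed.

End AddClique.

End IndependentSets.

Lemma independent_imset (T T' : finType) (e : rel T) (e' : rel T') (f : T -> T')
    (S : {set T}) :
  {mono f : x y / e x y >-> e' x y} -> independent e' (f @: S) = independent e S.
Proof.
move=> eE; apply/independentP/independentP => [indfS a b aS bS | indS].
  by rewrite -eE indfS ?imset_f.
by move=> _ _ /imsetP[a aS ->] /imsetP[b bS ->]; rewrite eE indS.
Qed.

Lemma indep_sets_imset (T T' : finType) (e : rel T) (e' : rel T') (f : T -> T')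
    (B : {set T'}) (A : {set T}) (k p : int) :
  injective f -> {mono f : x y / e x y >-> e' x y} ->
  indep_sets e' B (f @: A) k p
  = [set f @: S | S : {set T} in indep_sets e (f @^-1: B) A k p].
Proof.
move=> f_inj eE.
have fIB (S : {set T}) : f @: S :&: B = f @: (S :&: f @^-1: B).
  apply/setP => y; rewrite inE; apply/andP/imsetP => [[/imsetP[x xS ->] xB] | [x]].
    by exists x; rewrite // !inE xS.
  by rewrite !inE => /andP[xS xB] ->; rewrite imset_f.
have memE (S : {set T}) :
    (f @: S \in indep_sets e' B (f @: A) k p) = (S \in indep_sets e (f @^-1: B) A k p).
  rewrite !inE (independent_imset _ eE) fIB !(card_imset _ f_inj) sub_imset_pre.
  by congr (_ && _); apply: eq_subset_r => x; rewrite inE mem_imset.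
apply/setP => S'; apply/idP/imsetP => [S'A | [S SA ->]]; last by rewrite memE.
have fS' : f @: (f @^-1: S') = S'.
  by apply: (@imset_preimset _ _ _ A); move: S'A; rewrite inE => /andP[].
by exists (f @^-1: S'); rewrite ?fS' // -memE fS'.
Qed.

Section Attack.

Variable m : nat.
Implicit Types a b : 'I_m * 'I_m.

Lemma square_eqE a b : (a == b) = (a.1 == b.1 :> nat) && (a.2 == b.2 :> nat).
Proof. by case: a b => [? ?] [? ?]. Qed.

Lemma attackE a b :
  attack a b = (a != b) && ((a.1 == b.1 :> nat) || (a.1 + b.2 == b.1 + a.2)%N).
Proof. by rewrite /attack; congr (_ && (_ || _)); lia. Qed.

Lemma attack_sym : symmetric (@attack m).
Proof. by move=> a b; rewrite !attackE eq_sym; congr (_ && _); lia. Qed.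

Lemma attack_irr : irreflexive (@attack m).
Proof. by move=> a; rewrite /attack eqxx. Qed.

Lemma column_inj (S : {set 'I_m * 'I_m}) : nonattacking S -> {in S &, injective fst}.
Proof.
move=> /independentP indS a b aS bS eq1; apply/eqP.
by apply: contraNT (indS a b aS bS) => ab; rewrite /attack ab eq1 eqxx.
Qed.

End Attack.

Definition below_squares (m : nat) : {set 'I_m * 'I_m} :=
  [set a : 'I_m * 'I_m | (a.2 < a.1)%N].

Definition diagonal_squares (m : nat) : {set 'I_m * 'I_m} :=
  [set a : 'I_m * 'I_m | a.1 == a.2].

Definition last_column_below (m : nat) : {set 'I_m.+1 * 'I_m.+1} :=
  [set a : 'I_m.+1 * 'I_m.+1 | (a.1 == m :> nat) && (a.2 < m)%N].

Definition inner_squares (m : nat) : {set 'I_m.+1 * 'I_m.+1} :=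
  [set a : 'I_m.+1 * 'I_m.+1 | (a.1 != m :> nat) && (a.1 != a.2)].

(* Skips the diagonal and the last column of the larger board. *)
Definition board_embed {m : nat} (a : 'I_m * 'I_m) : 'I_m.+1 * 'I_m.+1 :=
  let i := widen_ord (leqnSn m) a.1 in (i, lift i a.2).

Definition AS_offdiag (m : nat) (k p : int) : int :=
  #|indep_sets (@attack m) (below_squares m) (~: diagonal_squares m) k p|%:Z.

Lemma AS_indep_sets (m : nat) (k p : int) :
  AS m k p = #|indep_sets (@attack m) (below_squares m) setT k p|%:Z.
Proof.
rewrite /AS; case: ifP => [kp | /norP[]].
  by rewrite indep_sets_eq0 ?cards0 //; lia.
case: k p => [k|//] [p|//] _ _; congr Posz; apply: eq_card => S.
rewrite !inE subsetT /= !eqz_nat /below.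
by do 2!congr (_ && _); congr (#|pred_of_set _| == p); apply/setP => a; rewrite !inE.
Qed.

Lemma AS_eq0 (m : nat) (k p : int) : ~~ [&& 0 <= p, p <= k & k <= m%:Z] -> AS m k p = 0.
Proof.
move=> mkp; rewrite AS_indep_sets.
have [pk | pk] := boolP (0 <= p <= k); last by rewrite indep_sets_eq0 // cards0.
apply/eqP; rewrite eqz_nat cards_eq0 -subset0; apply/subsetP => S.
rewrite inE => /and4P[_ indS kS _]; rewrite inE.
have : (#|S| <= #|'I_m|)%N by exact: leq_card_in (column_inj indS).
by rewrite card_ord; move: kS; lia.
Qed.

Lemma AS_offdiag_eq0 (m : nat) (k p : int) : ~~ (0 <= p <= k) -> AS_offdiag m k p = 0.
Proof. by move=> pk; rewrite /AS_offdiag indep_sets_eq0 ?cards0. Qed.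

Lemma AS00 (m : nat) : AS m 0 0 = 1.
Proof.
rewrite AS_indep_sets (_ : indep_sets _ _ _ _ _ = [set set0]) ?cards1 //.
apply/setP => S; rewrite !inE subsetT !eqz_nat !cards_eq0 /=.
case: eqP => [-> | _]; last by rewrite andbF.
by rewrite set0I eqxx !andbT; apply/independentP => a; rewrite inE.
Qed.

Section BoardEmbedding.

Variable m : nat.
Implicit Types a b : 'I_m * 'I_m.

Lemma board_embed_inj : injective (@board_embed m).
Proof.
move=> a b /eqP; rewrite square_eqE /= /bump => ab; apply/eqP; rewrite square_eqE.
by move: ab; lia.
Qed.

Lemma attack_board_embed : {mono @board_embed m : a b / attack a b}.
Proof.
move=> a b; rewrite !attackE (inj_eq board_embed_inj); congr (_ && _).
by rewrite /= /bump; lia.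
Qed.

Lemma board_embed_below : board_embed @^-1: below_squares m.+1 = below_squares m.
Proof. by apply/setP => a; rewrite !inE /= /bump; lia. Qed.

Lemma board_embed_setT : @board_embed m @: setT = inner_squares m.
Proof.
apply/setP => a; rewrite inE -val_eqE; apply/imsetP/idP => [[b _ ->]|].
  by have := ltn_ord b.1; rewrite /= /bump; lia.
case: a => [[i im] [j jm]] /= inner.
have im' : (i < m)%N by lia.
have jm' : (unbump i j < m)%N by rewrite /unbump; lia.
exists (Ordinal im', Ordinal jm') => //; apply/eqP; rewrite square_eqE /=.
by rewrite /bump /unbump; lia.
Qed.

Lemma AS_inner_squares (k p : int) :
  AS m k p
  = #|indep_sets (@attack m.+1) (below_squares m.+1) (inner_squares m) k p|%:Z.
Proof.
rewrite -board_embed_setT (indep_sets_imset _ _ _ _ board_embed_inj attack_board_embed).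
by rewrite (card_imset _ (imset_inj board_embed_inj)) board_embed_below AS_indep_sets.
Qed.

End BoardEmbedding.

Lemma card_diagonal_squares (m : nat) : #|diagonal_squares m| = m.
Proof.
have inj : injective (fun j : 'I_m => (j, j)) by move=> i j [].
rewrite -[RHS]card_ord -(card_imset _ inj); apply: eq_card => -[i j].
by rewrite inE /=; apply/eqP/imsetP => [-> | [l _ [-> ->]]]; first exists j.
Qed.

Lemma setC_diagonal_squares (m : nat) :
  ~: diagonal_squares m.+1 = inner_squares m :|: last_column_below m.
Proof.
apply/setP => -[i j]; rewrite !inE -val_eqE /=.
by have := ltn_ord i; have := ltn_ord j; lia.
Qed.

Lemma card_last_column_below (m : nat) : #|last_column_below m| = m.
Proof.
have inj : injective (fun j : 'I_m => (ord_max : 'I_m.+1, widen_ord (leqnSn m) j)).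
  by move=> i j [] /= ?; apply/val_inj.
rewrite -[RHS]card_ord -(card_imset _ inj); apply: eq_card => -[i j].
rewrite inE /=; apply/andP/imsetP => [[im jm] | [l _ [-> ->]]] /=; last by [].
by exists (Ordinal jm) => //; apply/eqP; rewrite square_eqE im /=.
Qed.

Lemma card_nonadjacent_diagonal (m : nat) (S : {set 'I_m * 'I_m}) :
  S \subset ~: diagonal_squares m -> nonattacking S ->
  #|[set q in diagonal_squares m | nonadjacent (@attack m) S q]|%:Z = m%:Z - #|S|%:Z.
Proof.
move=> /subsetP S_off indS.
rewrite (@card_nonadjacent_inj _ _ _ S S (fun s => (s.1, s.1))) ?card_diagonal_squares //.
- by move=> s _; rewrite inE.
- by move=> s s' sS s'S [eq1 _]; apply: (column_inj indS).
move=> q s; rewrite inE => /eqP q_diag sS; have := S_off s sS.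
rewrite !inE sS -val_eqE /= attackE !square_eqE /= -q_diag.
by lia.
Qed.

(* A below-diagonal piece blocks the square of the last column on its own diagonal, and
   the other pieces block none. *)
Lemma card_nonadjacent_last_column (m : nat) (S : {set 'I_m.+1 * 'I_m.+1}) :
  S \subset inner_squares m -> nonattacking S ->
  #|[set q in last_column_below m | nonadjacent (@attack m.+1) S q]|%:Z
  = m%:Z - #|S :&: below_squares m.+1|%:Z.
Proof.
move=> /subsetP S_inner indS.
pose row (s : 'I_m.+1 * 'I_m.+1) : 'I_m.+1 := inord (m - (s.1 - s.2)).
have rowE s : row s = (m - (s.1 - s.2))%N :> nat by rewrite inordK //; lia.
rewrite (@card_nonadjacent_inj _ _ _ S (S :&: below_squares m.+1)
  (fun s => (ord_max, row s))).
- by rewrite card_last_column_below.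
- exact: subsetIl.
- move=> [i j] /setIP[_]; rewrite !inE /= rowE eqxx /=.
  by have := ltn_ord i; lia.
- move=> [i j] [i' j'] /setIP[sS s_below] /setIP[s'S s'_below] [/(congr1 val)].
  rewrite /= !rowE /= => row_eq; apply/eqP; move: s_below s'_below; rewrite !inE.
  have := independentP _ _ indS _ _ sS s'S; rewrite attackE.
  by have := ltn_ord i; have := ltn_ord i'; case: eqP => //= _; lia.
- move=> [a b] [i j] q_col sS; have := S_inner _ sS; move: q_col.
  rewrite !inE sS /= attackE !square_eqE /= rowE -val_eqE /=.
  by have := ltn_ord i; have := ltn_ord j; lia.
Qed.

Lemma AS_eq_offdiag (m : nat) (k p : int) :
  AS m k p = AS_offdiag m k p + (m%:Z - k + 1) * AS_offdiag m (k - 1) p.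
Proof.
rewrite AS_indep_sets -(setUCr (diagonal_squares m)) setUC /AS_offdiag.
rewrite -[in X in _ * X](subr0 p); apply: (card_indep_sets_setU_clique_const (b := false)).
- exact: attack_sym.
- exact: attack_irr.
- by rewrite -setI_eq0 setIC setICr.
- by move=> a b; rewrite !inE attackE -!val_eqE /= => ? ? -> /=; lia.
- by move=> a; rewrite !inE => /eqP ->; rewrite ltnn.
move=> S; rewrite inE => /and4P[S_off indS /eqP kS _].
by rewrite card_nonadjacent_diagonal // kS; lia.
Qed.

Lemma AS_offdiag_rec (m : nat) (k p : int) :
  AS_offdiag m.+1 k p = AS m k p + (m%:Z - p + 1) * AS m (k - 1) (p - 1).
Proof.
rewrite /AS_offdiag setC_diagonal_squares !AS_inner_squares.
apply: (card_indep_sets_setU_clique_const (b := true)).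
- exact: attack_sym.
- exact: attack_irr.
- by rewrite -setI_eq0; apply/eqP/setP => a; rewrite !inE; lia.
- by move=> a b; rewrite !inE attackE => ? ? -> /=; lia.
- by move=> a; rewrite !inE; lia.
move=> S; rewrite inE => /and4P[S_inner indS _ /eqP pS].
by rewrite card_nonadjacent_last_column // pS; lia.
Qed.

Section AddDerivative.

Variable R : nzSemiRingType.
Implicit Types q r : {poly R}.

Definition addderiv q : {poly R} := q + q^`().

Lemma addderivD : {morph addderiv : q r / q + r}.
Proof. by move=> q r; rewrite /addderiv derivD addrACA. Qed.

Lemma iter_addderivD (u : nat) : {morph iter u addderiv : q r / q + r}.
Proof. by move=> q r; elim: u => //= u ->; rewrite addderivD. Qed.

Lemma deriv_iter_addderiv (u : nat) q :
  (iter u addderiv q)^`() = iter u addderiv q^`().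
Proof. by elim: u => //= u <-; rewrite /addderiv derivD. Qed.

Lemma iter_addderivMX (u : nat) q :
  iter u.+1 addderiv (q * 'X) = iter u.+1 addderiv q * 'X + iter u addderiv q *+ u.+1.
Proof.
have addderivMX r : addderiv (r * 'X) = addderiv r * 'X + r.
  by rewrite /addderiv derivM derivX mulr1 mulrDl addrA addrAC.
elim: u => [|u IH]; first by rewrite /= addderivMX mulr1n.
rewrite iterS IH addderivD addderivMX -addrA; congr (_ + _).
by rewrite /addderiv derivMn -mulrnDl [in RHS]mulrS.
Qed.

Lemma iter_addderivE (u : nat) q :
  iter u addderiv q = \sum_(0 <= j < u.+1) q^`(j) *+ 'C(u, j).
Proof.
elim: u => [|u IH]; first by rewrite big_nat1.
rewrite iterS /addderiv IH raddf_sum big_nat_recl // [in RHS]big_nat_recl // -addrA !bin0.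
congr (_ + _); under [X in _ = X]eq_bigr do rewrite binS mulrnDr.
rewrite big_split /= [X in _ = X + _]big_nat_recr //= bin_small // mulr0n addr0.
by congr (_ + _); apply: eq_bigr => j _; rewrite derivMn.
Qed.

Lemma coef_iter_addderiv (u : nat) q (n : nat) :
  (iter u addderiv q)`_n = \sum_(0 <= j < u.+1) q`_(n + j) *+ ((n + j) ^_ j * 'C(u, j)).
Proof.
rewrite iter_addderivE coef_sum; apply: eq_bigr => j _.
by rewrite coefMn coef_derivn addnC mulrnA.
Qed.

End AddDerivative.

Arguments addderiv {R} q.

Lemma stir2_small (n r : nat) : (n < r)%N -> stir2 n r = 0%N.
Proof. by elim: n r => [|n IH] [|r] //= nr; rewrite !IH ?muln0 // ltnW. Qed.

Lemma stir2SS (n r : nat) : stir2 n.+1 r.+1 = (r.+1 * stir2 n r.+1 + stir2 n r)%N.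
Proof. by []. Qed.

Definition touchard_poly (m : nat) : {poly int} := \poly_(n < m.+1) (stir2 m n)%:Z.

Definition bin_stir2_poly (m u : nat) : {poly int} :=
  \poly_(n < m.+1) ('C(m - n, u) * stir2 m.+1 n.+1)%N%:Z.

Lemma coef_touchard_poly (m n : nat) : (touchard_poly m)`_n = (stir2 m n)%:Z.
Proof. by rewrite coef_poly ltnS; case: leqP => // mn; rewrite stir2_small. Qed.

Lemma coef_bin_stir2_poly (m u n : nat) :
  (bin_stir2_poly m u)`_n = ('C(m - n, u) * stir2 m.+1 n.+1)%N%:Z.
Proof. by rewrite coef_poly ltnS; case: leqP => // mn; rewrite stir2_small ?muln0. Qed.

Lemma touchard_polyS (m : nat) : touchard_poly m.+1 = addderiv (touchard_poly m) * 'X.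
Proof.
apply/polyP => -[|n]; rewrite coefMX coef_touchard_poly //=.
by rewrite coefD coef_deriv !coef_touchard_poly -mulr_natl natz -PoszM -PoszD addnC.
Qed.

Lemma touchard_polyS_bin_stir2 (m : nat) : touchard_poly m.+1 = bin_stir2_poly m 0 * 'X.
Proof.
apply/polyP => -[|n]; rewrite coefMX coef_touchard_poly //=.
by rewrite coef_bin_stir2_poly bin0 mul1n.
Qed.

Lemma bin_stir2_polyS (m u : nat) :
  bin_stir2_poly m.+1 u.+1
  = addderiv (bin_stir2_poly m u.+1 * 'X) + (bin_stir2_poly m u * 'X)^`().
Proof.
apply/polyP => n; rewrite /addderiv !(coefD, coef_deriv, coefMX) -addrA -mulrnDl /=.
rewrite !coef_bin_stir2_poly -mulr_natl natz stir2SS mulnDr PoszD [LHS]addrC; congr (_ + _).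
  by case: n => [|n]; rewrite //= muln0.
have [mn | nm] := ltnP m n; first by rewrite stir2_small // !muln0 mulr0.
by rewrite subSn // binS -PoszD -mulnDl -PoszM mulnCA.
Qed.

Definition AS_poly (m u : nat) : {poly int} :=
  \poly_(n < m.+1) AS m (m%:Z - n%:Z) (m%:Z - n%:Z - u%:Z).

Definition AS_offdiag_poly (m u : nat) : {poly int} :=
  \poly_(n < m.+1) AS_offdiag m (m%:Z - n%:Z) (m%:Z - n%:Z - u%:Z).

Lemma coef_AS_poly (m u n : nat) :
  (AS_poly m u)`_n = AS m (m%:Z - n%:Z) (m%:Z - n%:Z - u%:Z).
Proof. by rewrite coef_poly ltnS; case: leqP => // mn; rewrite AS_eq0 //; lia. Qed.

Lemma coef_AS_offdiag_poly (m u n : nat) :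
  (AS_offdiag_poly m u)`_n = AS_offdiag m (m%:Z - n%:Z) (m%:Z - n%:Z - u%:Z).
Proof. by rewrite coef_poly ltnS; case: leqP => // mn; rewrite AS_offdiag_eq0 //; lia. Qed.

Lemma AS_poly0 (m : nat) : AS_poly m 0 = AS_offdiag_poly m 0.
Proof.
apply/polyP => n; rewrite coef_AS_poly coef_AS_offdiag_poly AS_eq_offdiag.
by rewrite [X in _ * X]AS_offdiag_eq0 ?mulr0 ?addr0 //; lia.
Qed.

Lemma AS_polyS (m u : nat) :
  AS_poly m u.+1 = AS_offdiag_poly m u.+1 + (AS_offdiag_poly m u)^`().
Proof.
apply/polyP => n; rewrite coefD coef_deriv !(coef_AS_poly, coef_AS_offdiag_poly).
rewrite AS_eq_offdiag -mulr_natl natz; congr (_ + _ * AS_offdiag _ _ _); lia.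
Qed.

Lemma AS_offdiag_polyS (m u : nat) :
  AS_offdiag_poly m.+1 u = addderiv (AS_poly m u) * 'X + AS_poly m u *+ u.
Proof.
apply/polyP => n; rewrite coefD coefMX coefMn coef_AS_offdiag_poly AS_offdiag_rec.
have -> : m.+1%:Z - n%:Z - 1 = m%:Z - n%:Z by lia.
have -> : m.+1%:Z - n%:Z - u%:Z - 1 = m%:Z - n%:Z - u%:Z by lia.
have -> : m%:Z - (m.+1%:Z - n%:Z - u%:Z) + 1 = n%:Z + u%:Z by lia.
rewrite -coef_AS_poly mulrDl addrA -[in RHS]mulr_natl natz; congr (_ + _).
case: n => [|n] /=; first by rewrite mul0r addr0 AS_eq0 //; lia.
rewrite coefD coef_deriv -mulr_natl natz; congr (_ + _).
by rewrite coef_AS_poly; congr AS; lia.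
Qed.

Lemma AS_poly_closed_form (m : nat) :
  AS_poly m 0 = touchard_poly m /\
  forall u, AS_poly m u.+1 = iter u addderiv (bin_stir2_poly m u.+1).
Proof.
elim: m => [|m [IH0 IHS]].
  split=> [|u]; apply/polyP => n; rewrite coef_AS_poly.
    by rewrite coef_touchard_poly; case: n => [|n]; rewrite ?AS00 // AS_eq0 //; lia.
  rewrite AS_eq0; last by lia.
  rewrite coef_iter_addderiv big1 // => j _.
  by rewrite coef_bin_stir2_poly sub0n bin0n mul0n mul0rn.
have offdiagE u : AS_offdiag_poly m.+1 u = iter u addderiv (bin_stir2_poly m u * 'X).
  rewrite AS_offdiag_polyS; case: u => [|u].
    by rewrite IH0 -touchard_polyS touchard_polyS_bin_stir2 addr0.
  by rewrite IHS iter_addderivMX.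
split=> [|u]; first by rewrite AS_poly0 offdiagE touchard_polyS_bin_stir2.
rewrite AS_polyS !offdiagE bin_stir2_polyS iter_addderivD.
by rewrite -iterSr deriv_iter_addderiv.
Qed.

Lemma sum_nat_widen0 (V : nmodType) (F : nat -> V) (a b : nat) : (a <= b)%N ->
  (forall j, (a <= j)%N -> F j = 0) -> \sum_(0 <= j < a) F j = \sum_(0 <= j < b) F j.
Proof.
move=> ab F0; rewrite [RHS](big_cat_nat _ (n := a)) //=.
rewrite [X in _ + X]big_nat_cond [X in _ + X]big1 ?addr0 // => j /andP[/andP[aj _] _].
exact: F0.
Qed.

Lemma AS_below_diagonal (n p : nat) : AS (n + p)%N p p = (stir2 (n + p) n)%:Z.
Proof.
by rewrite -coef_touchard_poly -(AS_poly_closed_form _).1 coef_AS_poly; congr AS; lia.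
Qed.

Lemma AS_eq_sum_bin_stir2 (n u p : nat) (k := (u.+1 + p)%N) :
  AS (n + k)%N k p = \sum_(0 <= j < p.+1)
    ((n + j) ^_ j * 'C(u, j) * 'C(k - j, u.+1) * stir2 (n + k).+1 (n + j).+1)%N%:Z.
Proof.
set F := BIG_F; have -> : AS (n + k)%N k p = (AS_poly (n + k) u.+1)`_n.
  by rewrite coef_AS_poly; congr AS; lia.
have -> : (AS_poly (n + k) u.+1)`_n = \sum_(0 <= j < u.+1) F j.
  rewrite (AS_poly_closed_form _).2 coef_iter_addderiv; apply: eq_bigr => j _.
  by rewrite /F coef_bin_stir2_poly subnDl -mulr_natl natz -PoszM mulnA.
rewrite (sum_nat_widen0 (b := k.+1)) ?(@sum_nat_widen0 _ _ p.+1 k.+1) //; try lia.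
- by move=> j pj; rewrite /F [X in (_ * X * _)%N]bin_small ?muln0 // /k; lia.
- by move=> j uj; rewrite /F bin_small ?muln0.
Qed.

Lemma sum_stir2_alternating (m n N : nat) :
  \sum_(0 <= j < N) (-1) ^+ j * ((n + j) ^_ j * stir2 m.+1 (n + j).+1)%N%:Z
  = (stir2 m n)%:Z - (-1) ^+ N * ((n + N) ^_ N * stir2 m (n + N))%N%:Z.
Proof.
elim: N => [|N IH]; first by rewrite big_nil addn0 mul1r mul1n subrr.
rewrite big_nat_recr //= IH addnS ffactSS exprS !(PoszM, PoszD); ring.
Qed.

Lemma stirlingZ_nat (n r : nat) : stirlingZ n%:Z r%:Z = (stir2 n r)%:Z.
Proof. by []. Qed.

Lemma stirlingZ_eq0 (n : nat) (r : int) :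
  ~~ (0 < r <= n%:Z + 1) -> stirlingZ (n%:Z + 1) r = 0.
Proof.
have -> : n%:Z + 1 = n.+1 by lia.
by case: r => [[|r]|r] // nr; rewrite stirlingZ_nat stir2_small //; lia.
Qed.

Lemma ffactZ0 (x : int) : ffact x 0 = 1.
Proof. by rewrite /ffact big_ord0. Qed.

Lemma ffactZSr (x : int) (j : nat) : ffact x j.+1 = ffact x j * (x - j%:Z).
Proof. by rewrite /ffact big_ord_recr. Qed.

Lemma ffactZ_nat (n j : nat) : ffact n%:Z j = (n ^_ j)%:Z.
Proof.
elim: j => [|j IH]; first by rewrite ffactZ0.
rewrite ffactZSr IH ffactnSr PoszM.
have [jn | nj] := leqP j n; first by rewrite subzn.
by rewrite ffact_small // !mul0r.
Qed.

Lemma ffactZN1 (j : nat) : ffact (-1) j = (-1) ^+ j * (j`!)%:Z.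
Proof.
elim: j => [|j IH]; first by rewrite ffactZ0.
by rewrite ffactZSr IH factS exprS PoszM; lia.
Qed.

Lemma binom_posE (x c : int) (r : nat) : ffact x r = c * (r`!)%:Z -> binom_pos x r = c.
Proof. by rewrite /binom_pos /ffact => ->; rewrite mulzK // eqz_nat -lt0n fact_gt0. Qed.

Lemma binomZ_nat (n r : nat) : binomZ n%:Z r%:Z = 'C(n, r)%:Z.
Proof. by apply: binom_posE; rewrite ffactZ_nat -bin_ffact PoszM. Qed.

Lemma binomZ0 (x : int) : binomZ x 0 = 1.
Proof. by apply: (@binom_posE _ _ 0); rewrite ffactZ0. Qed.

Lemma binomZN1 (r : nat) : binomZ (-1) r%:Z = (-1) ^+ r.
Proof. exact: binom_posE (ffactZN1 r). Qed.

Definition AS_summand (m k p j : nat) : int :=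
  ffact (m%:Z - k%:Z + j%:Z) j
  * binomZ (k%:Z - p%:Z - 1) j%:Z
  * binomZ (k%:Z - j%:Z) (k%:Z - p%:Z)
  * stirlingZ (m%:Z + 1) (m%:Z - k%:Z + j%:Z + 1).

Lemma AS_summandE (n u p j : nat) (k := (u + p)%N) : (j <= p)%N ->
  AS_summand (n + k) k p j
  = binomZ (u%:Z - 1) j%:Z
    * ((n + j) ^_ j * 'C(k - j, u) * stir2 (n + k).+1 (n + j).+1)%N%:Z.
Proof.
move=> jp; rewrite /AS_summand.
have -> : (n + k)%N%:Z - k%:Z + j%:Z = (n + j)%N%:Z by lia.
have -> : k%:Z - p%:Z = u%:Z by lia.
have -> : k%:Z - j%:Z = (k - j)%N%:Z by lia.
have addn1Z r : r%:Z + 1 = r.+1%:Z by lia.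
by rewrite !addn1Z ffactZ_nat binomZ_nat stirlingZ_nat !PoszM; ring.
Qed.

Lemma AS_summand_eq0 (m k p j : nat) :
  ~~ (p <= k <= m)%N -> (j <= p)%N -> AS_summand m k p j = 0.
Proof.
move=> pkm jp; rewrite /AS_summand.
have [/stirlingZ_eq0 -> | ] := boolP (~~ (0 < m%:Z - k%:Z + j%:Z + 1 <= m%:Z + 1)).
  by rewrite mulr0.
rewrite negbK => jkm; have [pk | kp] := leqP p k.
  have -> : m%:Z - k%:Z + j%:Z = (m + j - k)%N%:Z by lia.
  by rewrite ffactZ_nat ffact_small ?mul0r //; lia.
rewrite [binomZ (_ - j%:Z) _](_ : _ = 0) ?mulr0 ?mul0r //.
by rewrite /binomZ !ifF //; lia.
Qed.

Lemma AS_closed_formula (m k p : nat) : AS m k p = \sum_(0 <= j < p.+1) AS_summand m k p j.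
Proof.
have [/andP[pk km] | pkm] := boolP (p <= k <= m)%N; last first.
  rewrite AS_eq0; last by lia.
  by rewrite big_nat big1 // => j /andP[_ jp]; apply: AS_summand_eq0.
rewrite -(subnK km); move: (m - k)%N => n {m km}.
rewrite -(subnK pk); move: (k - p)%N => [|u] {k pk}.
  under eq_big_nat => j /andP[_ jp].
    rewrite AS_summandE // bin0 muln1 sub0r binomZN1; over.
  rewrite sum_stir2_alternating AS_below_diagonal.
  by rewrite [stir2 _ (n + p.+1)]stir2_small ?muln0 ?mulr0 ?subr0 //; lia.
rewrite AS_eq_sum_bin_stir2; apply: eq_big_nat => j /andP[_ jp].
rewrite AS_summandE // (_ : u.+1%:Z - 1 = u%:Z); last lia.
by rewrite binomZ_nat -PoszM; congr Posz; ring.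
Qed.

Lemma AS_rec (m : nat) (k p : int) :
  AS m.+1 k p =
    AS m k p
    + (m.+1%:Z - k + 1) * AS m (k - 1) p
    + (m.+1%:Z - p) * AS m (k - 1) (p - 1)
    + (m.+1%:Z - p) * (m.+1%:Z - k + 1) * AS m (k - 2) (p - 1).
Proof.
rewrite AS_eq_offdiag !AS_offdiag_rec (_ : k - 1 - 1 = k - 2); last by lia.
by rewrite (_ : m.+1%:Z = m%:Z + 1); [ring | lia].
Qed.

Lemma AS_no_piece (m p : nat) : AS m 0 p = kdelta p 0.
Proof. by case: p => [|p]; [exact: AS00 | rewrite AS_eq0 //; lia]. Qed.

Lemma AS_empty_board (k p : nat) : AS 0 k p = kdelta k 0 * kdelta p 0.
Proof. by case: k => [|k]; [rewrite AS_no_piece mul1r | rewrite AS_eq0 ?mul0r //; lia]. Qed.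

Lemma AS_none_below (m k : nat) : AS m k 0 = stirlingZ (m%:Z + 1) (m%:Z - k%:Z + 1).
Proof.
rewrite AS_closed_formula big_nat1 /AS_summand addr0 !subr0 ffactZ0 mul1r.
by rewrite binomZ0 binomZ_nat binn !mul1r.
Qed.

Lemma AS_one_piece (m p : nat) :
  AS m.+1 1 p = stirlingZ (m.+1%:Z + 1) m.+1%:Z * kdelta p 0
                + stirlingZ m.+1%:Z (m.+1%:Z - 1) * kdelta p 1.
Proof.
case: p => [|[|p]].
- by rewrite (AS_none_below _ 1) subrK mulr1 mulr0 addr0.
- rewrite -addn1 AS_below_diagonal mulr0 mulr1 add0r -stirlingZ_nat.
  by congr stirlingZ; lia.
- by rewrite AS_eq0 ?mulr0.
Qed.

Theorem theorem3p1 :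
  (forall m k p : nat, (1 <= m)%N ->
     [/\ AS m k p =
           AS m.-1 k p
           + (m%:Z - k%:Z + 1) * AS m.-1 (k%:Z - 1) p
           + (m%:Z - p%:Z) * AS m.-1 (k%:Z - 1) (p%:Z - 1)
           + (m%:Z - p%:Z) * (m%:Z - k%:Z + 1) * AS m.-1 (k%:Z - 2) (p%:Z - 1),
         AS m 0 p = kdelta p 0,
         AS m 1 p = stirlingZ (m%:Z + 1) m%:Z * kdelta p 0
                    + stirlingZ m%:Z (m%:Z - 1) * kdelta p 1
       & AS m k 0 = stirlingZ (m%:Z + 1) (m%:Z - k%:Z + 1)]) /\
  (forall k p : nat, AS 0 k p = kdelta k 0 * kdelta p 0) /\
  (forall m k p : nat,
     AS m k p =
       \sum_(0 <= j < p.+1)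
          ffact (m%:Z - k%:Z + j%:Z) j
          * binomZ (k%:Z - p%:Z - 1) j%:Z
          * binomZ (k%:Z - j%:Z) (k%:Z - p%:Z)
          * stirlingZ (m%:Z + 1) (m%:Z - k%:Z + j%:Z + 1)).
Proof.
split; last by split; [exact: AS_empty_board | exact: AS_closed_formula].
move=> [//|m] k p _; split.
- exact: AS_rec.
- exact: AS_no_piece.
- exact: AS_one_piece.
- exact: AS_none_below.
Qed.
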